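(* Let $a_1,a_2$ and $a_3$ be integers and let $\{U_n\}$ be the third-order recurrence sequence defined by $$U_0=0,\quad U_1=1,\quad U_2=-a_1,\qquad U_{n+3}+a_1U_{n+2}+a_2U_{n+1}+a_3U_n=0\quad (n\ge 0).$$ Let $f=x^3+a_1x^2+a_2x+a_3$ and put $D=\mathrm{disc}(f)$. Given a prime $p$ we have $$N_p(f)=\begin{cases}3 & \text{if } DU_{p-1}^2\equiv 0 \pmod p;\\ 0 & \text{if } DU_{p-1}^2\equiv (a_1^2-3a_2)^2 \pmod p;\\ 1 & \text{otherwise,}\end{cases}$$ with at most finitely many exceptions.
   Context: For a polynomial $f\in\mathbb{Z}[x]$ and a prime $p$, $N_p(f)$ denotes the number of integers $0\le a<p$ with $f(a)\equiv 0\pmod p$. $\mathrm{disc}(f)$ is the discriminant of $f$.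
   Formalization: Assumes D≠0; that f has an integer root if a_1^2=3a_2; and that D is a square if -a_1/3 is an integer root of f. Without these the claim fails for infinitely many p (e.g. x^3, x^3-2, x^3+x). Overlapping cases are read top-down. *)

(* Defs.v *)
From mathcomp Require Import all_boot all_order all_algebra.

Set Implicit Arguments.
Unset Strict Implicit.
Unset Printing Implicit Defensive.

Import Order.TTheory GRing.Theory Num.Theory.
Local Open Scope ring_scope.

(* disc f = (-1)^(n(n-1)/2) Res(f, f') / lead_coef f with n = deg f.  The
   integer division is exact: the first column of the Sylvester matrix, read
   from the leading coefficients, is divisible by lead_coef f. *)
Definition disc (f : {poly int}) : int :=
  (((-1) ^+ 'C((size f).-1, 2) * resultant f f^`()) %/ lead_coef f)%Z.

Definition Np (p : nat) (f : {poly int}) : nat :=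
  #|[set a : 'I_p | (f.[(a : nat)%:Z] == 0 %[mod p%:Z])%Z]|.

Definition cubic (a1 a2 a3 : int) : {poly int} :=
  'X^3 + a1 *: 'X^2 + a2 *: 'X + a3%:P.

(* Main.v *)
Require Import Defs.
From mathcomp Require Import all_boot all_order all_algebra all_field.
From mathcomp Require Import ring zify.
Import Order.TTheory GRing.Theory Num.Theory.
Local Open Scope ring_scope.

(** Over an algebraic closure of F_p, let x, y, z be the roots of f, let phi be
    the Frobenius and put V = (x - y)(x - z)(y - z).  A Binet formula gives
    V U_(p-1) = phi(x)(y - z) - phi(y)(x - z) + phi(z)(x - y), so D U_(p-1)^2 is
    the square of the right-hand side, while N_p(f) is the number of roots fixed
    by phi.  When phi permutes the roots trivially the right-hand side vanishes;
    when it is a 3-cycle it is +-(a1^2 - 3 a2), and when it fixes x and swaps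
    y, z it is (2x - y - z)(y - z).  The last value is nonzero unless 3x = -a1,
    which for almost all p forces f to have the integer root -a1/3, hence D to be
    a square by hypothesis, which is incompatible with an odd permutation. *)

(** * The discriminant of a monic cubic from its Sylvester determinant *)

Definition discriminant3 {R : pzRingType} (a b c : R) : R :=
  a ^+ 2 * b ^+ 2 - 4 * b ^+ 3 - 4 * a ^+ 3 * c - 27 * c ^+ 2 + 18 * a * b * c.

Lemma coef_cubic (a b c : int) i :
  (cubic a b c)`_i = [:: c; b; a; 1]`_i.
Proof.
rewrite !(coefD, coefZ, coefXn, coefX, coefC).
by case: i => [|[|[|[|i]]]]; rewrite /= ?nth_nil; ring.
Qed.

Lemma cubicE (a b c : int) : cubic a b c = Poly [:: c; b; a; 1].
Proof. by apply/polyP => i; rewrite coef_cubic coef_Poly. Qed.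

Lemma polyseq_cubic (a b c : int) : cubic a b c = [:: c; b; a; 1] :> seq int.
Proof. by rewrite cubicE (@PolyK _ 0). Qed.

Lemma polyseq_deriv_cubic (a b c : int) :
  (cubic a b c)^`() = [:: b; 2 * a; 3] :> seq int.
Proof.
have -> : (cubic a b c)^`() = Poly [:: b; 2 * a; 3].
  apply/polyP => i; rewrite coef_deriv coef_cubic coef_Poly.
  by case: i => [|[|[|[|i]]]] //=; rewrite ?nth_nil ?mul0rn //; ring.
by rewrite (@PolyK _ 0).
Qed.

(* Laplace expansion in a form that [simpl] evaluates on concrete sizes. *)
Fixpoint laplace {R : pzRingType} n (F : nat -> nat -> R) : R :=
  if n is n'.+1 then
    foldr (fun j s =>
        F 0 j * ((-1) ^+ j * laplace n' (fun i k => F i.+1 (bump j k))) + s)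
      0 (iota 0 n)
  else 1.

Lemma det_laplace (R : comPzRingType) n (F : nat -> nat -> R) :
  \det (\matrix_(i < n, j < n) F i j) = laplace n F.
Proof.
elim: n F => [|n IHn] F; first by rewrite det_mx00.
transitivity (\sum_(0 <= j < n.+1)
    F 0 j * ((-1) ^+ j * laplace n (fun i k => F i.+1 (bump j k)))); last first.
  by rewrite unlock /index_iota subn0.
rewrite (expand_det_row _ ord0) big_mkord; apply: eq_bigr => j _.
rewrite mxE /cofactor add0n -IHn; congr (_ * (_ * \det _)).
by apply/matrixP => i k; rewrite !mxE.
Qed.

(** The Sylvester rows are shifted coefficient lists; the multiplicity [i <= j] or [i - n <= j]
    kills the entries left of the shift, where truncated subtraction would give the constant
    coefficient. *)
Lemma resultant_laplace (R : comNzRingType) m n (p q : {poly R}) :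
  size p = m.+1 -> size q = n.+1 ->
  resultant p q = laplace (n + m) (fun i j =>
    if i < n then p`_(j - i) *+ (i <= j) else q`_(j - (i - n)) *+ (i - n <= j))%N.
Proof.
move=> [sp] [sq]; have {sp}[sp] : (size p).-1 = m by rewrite sp.
have {sq}[sq] : (size q).-1 = n by rewrite sq.
subst m n; rewrite -det_laplace; congr (\det _); apply/matrixP => i j.
by rewrite Sylvester_mxE mxE; case: splitP => k -> //; rewrite addKn.
Qed.

Lemma disc_cubic (a b c : int) : disc (cubic a b c) = discriminant3 a b c.
Proof.
rewrite /disc lead_coefE
  (@resultant_laplace _ 3 2) ?polyseq_deriv_cubic ?polyseq_cubic //=.
by rewrite divz1 /discriminant3; ring.
Qed.

(** * Roots modulo p as roots fixed by Frobenius *)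

Lemma natr_inj_pchar {K : nzRingType} {p : nat} (pK : p \in [pchar K]) :
  injective (fun k : 'I_p => (k : nat)%:R : K).
Proof.
suff le_eq (k l : 'I_p) : (k <= l)%N -> k%:R = l%:R :> K -> k = l.
  by move=> k l kl; case: (leqP k l) => [|/ltnW] h; [|symmetry]; apply: le_eq.
move=> le_kl eq_kl; apply: val_inj; apply/eqP; rewrite eqn_leq le_kl /=.
have : (p %| l - k)%N by rewrite (dvdn_pcharf pK) natrB // eq_kl subrr.
case: (posnP (l - k)) => [/eqP//|lk_gt0 /(dvdn_leq lk_gt0)].
by rewrite leqNgt (leq_ltn_trans (leq_subr _ _)).
Qed.

(** The images of 0, ..., p - 1 are already p distinct roots of X^p - X, so a further root would
    exceed its degree. *)
Lemma Frobenius_fixedP {K : fieldType} {p : nat} (pK : p \in [pchar K]) (x : K) :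
  reflect (exists k : 'I_p, x = (k : nat)%:R) (x ^+ p == x).
Proof.
have natK (k : nat) : k%:R ^+ p = k%:R :> K.
  by rewrite -(pFrobenius_autE pK) pFrobenius_aut_nat.
apply: (iffP eqP) => [xp|[k ->]]; last exact: natK.
pose s := codom (fun k : 'I_p => (k : nat)%:R : K).
suff /codomP[k ->] : x \in s by exists k.
apply: contraT => xNs; have p_gt1 := prime_gt1 (pcharf_prime pK).
have size_q : size ('X^p - 'X : {poly K}) = p.+1.
  by rewrite size_polyDl ?size_polyXn // size_polyN size_polyX ltnS.
have /max_poly_roots : 'X^p - 'X != 0 :> {poly K} by rewrite -size_poly_gt0 size_q.
move=> /(_ (x :: s)); rewrite size_q /= size_codom card_ord ltnn => -> //.
- rewrite !rootE !hornerE xp subrr eqxx /=; apply/allP => _ /codomP[k ->].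
  by rewrite !rootE !hornerE natK subrr.
- by rewrite xNs map_inj_uniq ?enum_uniq //; apply: natr_inj_pchar.
Qed.

Lemma Np_count_fixed {K : fieldType} {p : nat} (pK : p \in [pchar K])
    {f : {poly int}} {s : seq K} :
  uniq s -> map_poly intr f = \prod_(z <- s) ('X - z%:P) ->
  Np p f = count (fun z => z ^+ p == z) s.
Proof.
move=> s_uniq fs; pose g (k : 'I_p) : K := (k : nat)%:R.
have g_inj : injective g := natr_inj_pchar pK.
rewrite /Np; set S := [set _ | _].
have inS (k : 'I_p) : (k \in S) = (g k \in s).
  rewrite inE eqz_mod_dvd subr0 (dvdz_pcharf pK) -root_prod_XsubC -fs.
  by rewrite rootE -horner_map.
rewrite cardE -size_filter -(size_map g); apply/perm_size/uniq_perm.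
- by rewrite map_inj_uniq ?enum_uniq.
- exact: filter_uniq.
move=> z; rewrite mem_filter; apply/mapP/andP => [[k]|].
  rewrite mem_enum inS => ks ->; split=> //.
  by apply/(Frobenius_fixedP pK); exists k.
move=> [/(Frobenius_fixedP pK)[k ->]] ks; exists k => //.
by rewrite mem_enum inS.
Qed.

Lemma root_Frobenius {K : fieldType} {p : nat} (pK : p \in [pchar K])
    (f : {poly int}) (z : K) :
  root (map_poly intr f) z -> root (map_poly intr f) (z ^+ p).
Proof.
rewrite !rootE -(pFrobenius_autE pK) => /eqP fz.
have -> : map_poly intr f = map_poly (pFrobenius_aut pK) (map_poly intr f).
  by rewrite -map_poly_comp; apply: eq_map_poly => c /=; rewrite rmorph_int.
by rewrite horner_map fz rmorph0.
Qed.

(** * Permutations of the three roots *)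

Definition vandermonde3 {R : pzRingType} (x y z : R) : R := (x - y) * (x - z) * (y - z).

(** The determinant with rows (g t, t, 1) for t = x, y, z, expanded along its first column; squaring
    as g gives [vandermonde3]. *)
Definition alternating {R : pzRingType} (g : R -> R) (x y z : R) : R :=
  g x * (y - z) - g y * (x - z) + g z * (x - y).

Lemma alternating_transposition {K : fieldType} (phi : {rmorphism K -> K}) {x y z : K} :
  2 != 0 :> K -> 3 != 0 :> K -> vandermonde3 x y z != 0 ->
  (3 * x = x + y + z -> phi (vandermonde3 x y z) = vandermonde3 x y z) ->
  phi x = x -> phi y = z -> phi z = y ->
  let w := alternating phi x y z in
  w ^+ 2 != 0 /\ w ^+ 2 != ((x + y + z) ^+ 2 - 3 * (x * y + x * z + y * z)) ^+ 2.
Proof.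
move=> two three V0 mean px py pz w.
have yz0 : y - z != 0 by apply: contraNneq V0; rewrite /vandermonde3 => ->; rewrite mulr0.
pose s := 2 * x - y - z.
have wE : w = s * (y - z) by rewrite /w /alternating px py pz /s; ring.
have s0 : s != 0.
  (* If s = 0 then x is the mean of the roots, so [mean] makes phi fix V; the swap of y and z
     negates V, whence 2 V = 0. *)
  apply: contraNneq V0 => sE; have /mean : 3 * x = x + y + z.
    have -> : 3 * x = s + (x + y + z) by rewrite /s; ring.
    by rewrite sE add0r.
  rewrite /vandermonde3 !rmorphM !rmorphB /= px py pz => VE.
  by rewrite -(mulrI_eq0 _ (mulfI two)); apply/eqP; rewrite mulr_natl mulr2n -{1}VE; ring.
have ps : phi s = s by rewrite /s !rmorphB rmorphM rmorph_nat /= px py pz; ring.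
split; first by rewrite wE sqrf_eq0 mulf_neq0.
set E := _ - _; rewrite eqf_sqr.
have split_s (c : K) : phi c = c -> c != 0 -> s != c * (y - z).
  move=> pc c0; apply: contraNneq yz0 => sE.
  rewrite -(mulrI_eq0 _ (mulfI two)) -(mulrI_eq0 _ (mulfI c0)).
  have : phi s = c * (z - y) by rewrite sE rmorphM rmorphB /= pc py pz.
  rewrite ps sE => cE; apply/eqP.
  have -> : c * (2 * (y - z)) = c * (y - z) - c * (z - y) by ring.
  by rewrite cE subrr.
have phi3 : phi 3 = 3 by rewrite rmorph_nat.
have four : 4 != 0 :> K.
  have -> : 4 = 2 * 2 :> K by ring.
  by rewrite mulf_neq0.
(* As 4 E = s^2 + 3 (y - z)^2, w = +-E would make s one of +-(y - z), +-3 (y - z),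
   but phi fixes s and negates y - z. *)
apply/norP; split; rewrite -subr_eq0 -(mulrI_eq0 _ (mulfI four)).
  have -> : 4 * (w - E) = - (s - 1 * (y - z)) * (s - 3 * (y - z)).
    by rewrite wE /E /s; ring.
  by rewrite mulf_neq0 ?oppr_eq0 // subr_eq0 split_s ?rmorph1 ?oner_eq0.
have -> : 4 * (w - - E) = (s - -1 * (y - z)) * (s - -3 * (y - z)).
  by rewrite wE /E /s; ring.
by rewrite mulf_neq0 // subr_eq0 split_s ?rmorphN ?rmorph1 ?phi3 // oppr_eq0 ?oner_eq0.
Qed.

(** Case analysis on the permutation induced by phi. V, w and E are invariant under cyclic
    relabelling, which brings every transposition to the one fixing the first root. *)
Lemma count_fixed_roots {K : fieldType} (phi : {rmorphism K -> K}) (x y z : K) :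
  2 != 0 :> K -> 3 != 0 :> K -> vandermonde3 x y z != 0 ->
  {in [:: x; y; z], forall t, phi t \in [:: x; y; z]} ->
  {in [:: x; y; z], forall t, 3 * t = x + y + z ->
    phi (vandermonde3 x y z) = vandermonde3 x y z} ->
  let E := (x + y + z) ^+ 2 - 3 * (x * y + x * z + y * z) in
  let w := alternating phi x y z in
  (E = 0 -> exists2 t, t \in [:: x; y; z] & phi t = t) ->
  count (fun t => phi t == t) [:: x; y; z] =
    if w ^+ 2 == 0 then 3%N else if w ^+ 2 == E ^+ 2 then 0%N else 1%N.
Proof.
move=> two three V0 perm mean E w pure.
have [xs ys zs] : [/\ x \in [:: x; y; z], y \in [:: x; y; z] & z \in [:: x; y; z]].
  by rewrite !inE !eqxx !orbT.
have : [&& x - y != 0, x - z != 0 & y - z != 0].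
  by move: V0; rewrite /vandermonde3 !mulf_eq0 !negb_or andbA.
rewrite !subr_eq0 => /and3P[xy xz yz].
have inj : [&& phi x != phi y, phi x != phi z & phi y != phi z].
  by rewrite !(inj_eq (fmorph_inj phi)) xy xz.
have [VE1 VE2] : vandermonde3 y z x = vandermonde3 x y z /\
    vandermonde3 z x y = vandermonde3 x y z.
  by rewrite /vandermonde3; split; ring.
have [wE1 wE2] : alternating phi y z x = w /\ alternating phi z x y = w.
  by rewrite /w /alternating; split; ring.
have [EE1 EE2] : (y + z + x) ^+ 2 - 3 * (y * z + y * x + z * x) = E /\
    (z + x + y) ^+ 2 - 3 * (z * x + z * y + x * y) = E.
  by rewrite /E; split; ring.
(* Of the 27 maps on the roots, injectivity leaves the six permutations. *)
have := perm x xs; rewrite !inE => /or3P[] /eqP px;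
have := perm y ys; rewrite !inE => /or3P[] /eqP py;
have := perm z zs; rewrite !inE => /or3P[] /eqP pz;
  try by move: inj; rewrite px py pz ?eqxx ?andbF.
- have -> : w = 0 by rewrite /w /alternating px py pz; ring.
  by rewrite /= px py pz expr0n !eqxx.
- have [] := alternating_transposition phi two three V0 (mean x xs) px py pz.
  rewrite -/w -/E => /negbTE-> /negbTE->.
  by rewrite /= px py pz eqxx eq_sym (negbTE yz).
- have [] := @alternating_transposition _ phi z x y two three _ _ pz px py.
  + by rewrite VE2.
  + by rewrite VE2 => h; apply: (mean z zs); rewrite h; ring.
  rewrite wE2 EE2 => /negbTE-> /negbTE->.
  by rewrite /= px py pz eqxx eq_sym (negbTE xy).
- have wE : w = E by rewrite /w /alternating px py pz /E; ring.
  (* E = 0 would give a fixed root by [pure], but a 3-cycle has none. *)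
  have E0 : E != 0.
    apply/eqP => /pure[t]; rewrite !inE => /or3P[] /eqP-> /eqP.
    + by rewrite px eq_sym (negbTE xy).
    + by rewrite py eq_sym (negbTE yz).
    + by rewrite pz (negbTE xz).
  by rewrite wE sqrf_eq0 (negbTE E0) eqxx /= px py pz (eq_sym y x) (eq_sym z y)
    (negbTE xy) (negbTE yz) (negbTE xz).
- have wE : w = - E by rewrite /w /alternating px py pz /E; ring.
  have E0 : E != 0.
    apply/eqP => /pure[t]; rewrite !inE => /or3P[] /eqP-> /eqP.
    + by rewrite px eq_sym (negbTE xz).
    + by rewrite py (negbTE xy).
    + by rewrite pz (negbTE yz).
  by rewrite wE sqrrN sqrf_eq0 (negbTE E0) eqxx /= px py pz (eq_sym z x)
    (negbTE xy) (negbTE yz) (negbTE xz).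
- have [] := @alternating_transposition _ phi y z x two three _ _ py pz px.
  + by rewrite VE1.
  + by rewrite VE1 => h; apply: (mean y ys); rewrite h; ring.
  rewrite wE1 EE1 => /negbTE-> /negbTE->.
  by rewrite /= px py pz eqxx eq_sym (negbTE xz).
Qed.

(** * The Binet formula *)

(** Both sides satisfy the recurrence with characteristic roots x, y, z and agree at 0, 1, 2. The
    exponent n + 1 becomes p at n = p - 1, which brings in Frobenius. *)
Lemma alternating_recurrence {R : comNzRingType} (x y z : R) (u : nat -> R) :
  u 0%N = 0 -> u 1%N = 1 -> u 2%N = x + y + z ->
  (forall n, u (n + 3)%N - (x + y + z) * u (n + 2)%N
     + (x * y + x * z + y * z) * u (n + 1)%N - x * y * z * u n = 0) ->
  forall n, u n * vandermonde3 x y z = alternating (fun t => t ^+ n.+1) x y z.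
Proof.
move=> u0 u1 u2 urec n.
suff [] : [/\ u n * vandermonde3 x y z = alternating (fun t => t ^+ n.+1) x y z,
  u n.+1 * vandermonde3 x y z = alternating (fun t => t ^+ n.+2) x y z &
  u n.+2 * vandermonde3 x y z = alternating (fun t => t ^+ n.+3) x y z] by [].
elim: n => [|n [IH0 IH1 IH2]].
  by rewrite u0 u1 u2 /vandermonde3 /alternating; split; ring.
split=> //.
have -> : u n.+3 = (x + y + z) * u n.+2 - (x * y + x * z + y * z) * u n.+1
   + x * y * z * u n.
  by apply/eqP; rewrite -subr_eq0 -(urec n) addn1 addn2 addn3; apply/eqP; ring.
rewrite mulrDl mulrBl -!mulrA IH0 IH1 IH2 /alternating !exprS; ring.
Qed.

(** * Splitting the cubic, and its possible integer root -a/3 *)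

Lemma cubic_splits {K : closedFieldType} (a b c : int) :
  {s : K * K * K | let: (x, y, z) := s in
    map_poly intr (cubic a b c) = \prod_(t <- [:: x; y; z]) ('X - t%:P)}.
Proof.
have lead : lead_coef (map_poly intr (cubic a b c)) = 1 :> K.
  by rewrite lead_coef_map_eq lead_coefE polyseq_cubic /= ?rmorph1 ?oner_eq0.
have size3 : size (map_poly intr (cubic a b c) : {poly K}) = 4%N.
  by rewrite size_map_poly_id0 ?polyseq_cubic // lead_coefE polyseq_cubic /= oner_eq0.
have [s] := closed_field_poly_normal (map_poly intr (cubic a b c) : {poly K}).
rewrite lead scale1r => fs; move: size3; rewrite fs size_prod_XsubC.
by case: s fs => [|x [|y [|z []]]] // fs _; exists (x, y, z).
Qed.

Lemma cubic_Vieta {R : comNzRingType} {a b c : int} {x y z : R} :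
  map_poly intr (cubic a b c) = \prod_(t <- [:: x; y; z]) ('X - t%:P) ->
  [/\ a%:~R = - (x + y + z), b%:~R = x * y + x * z + y * z & c%:~R = - (x * y * z)].
Proof.
move=> fE.
have coef i : ([:: c; b; a; 1]`_i)%:~R = (('X - x%:P) * ('X - y%:P) * ('X - z%:P))`_i.
  by rewrite -coef_cubic -coef_map fE !big_cons big_nil mulr1 mulrA.
have prodE : ('X - x%:P) * ('X - y%:P) * ('X - z%:P) =
  'X^3 - (x + y + z)%:P * 'X^2 + (x * y + x * z + y * z)%:P * 'X - (x * y * z)%:P.
  by rewrite !(polyCD, polyCM); ring.
rewrite prodE in coef.
by split; [have := coef 2 | have := coef 1 | have := coef 0];
  rewrite /= !(coefB, coefD, coefCM, coefXn, coefX, coefC) /= => ->; ring.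
Qed.

(** The hypothesis says 27 f(-a/3) = 0. Modulo 3 it gives 2 a^3 = 0, so 3 divides a and -a/3 is an
    integer. *)
Lemma integer_mean_root (a b c : int) :
  2 * a ^+ 3 - 9 * a * b + 27 * c = 0 ->
  exists2 r : int, root (cubic a b c) r & 3 * r = - a.
Proof.
move=> g0.
have [k kE] : exists k : int, a = 3 * k.
  exists (a %/ 3)%Z; have := divz_eq a 3; have := modz_ge0 a (isT : 3 != 0 :> int).
  have := ltz_pmod a (isT : 0 < 3 :> int).
  move: (a %/ 3)%Z (a %% 3)%Z => q e; rewrite -ltzD1 => lt ge aE.
  have : e = 0 \/ e = 1 \/ e = 2 by lia.
  by case=> [|[]] eE; move: g0; rewrite aE eE; lia.
exists (- k); last by rewrite kE mulrN.
rewrite kE in g0 *.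
rewrite rootE /cubic !(hornerD, hornerZ, hornerXn, hornerX, hornerC).
apply/eqP/(mulfI (_ : 27 != 0 :> int)) => //.
by rewrite mulr0 -[RHS]g0; ring.
Qed.

(** * Reduction modulo a non-exceptional prime *)

Theorem theorem7 (a1 a2 a3 : int) (U : nat -> int)
    (U0 : U 0%N = 0) (U1 : U 1%N = 1) (U2 : U 2%N = - a1)
    (Urec : forall n : nat,
       U (n + 3)%N + a1 * U (n + 2)%N + a2 * U (n + 1)%N + a3 * U n = 0)
    (* the polynomials excluded by the next three hypotheses are exactly those
       for which the conclusion fails *)
    (hsep : disc (cubic a1 a2 a3) <> 0)
    (hpure : a1 ^+ 2 = 3 * a2 -> exists r : int, root (cubic a1 a2 a3) r)
    (hmean : forall r : int, root (cubic a1 a2 a3) r -> 3 * r = - a1 ->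
       exists s : int, disc (cubic a1 a2 a3) = s ^+ 2) :
  exists exceptions : seq nat,
    forall p : nat, prime p -> p \notin exceptions ->
      Np p (cubic a1 a2 a3) =
        (if (disc (cubic a1 a2 a3) * U p.-1 ^+ 2 == 0 %[mod p%:Z])%Z then 3%N
         else if (disc (cubic a1 a2 a3) * U p.-1 ^+ 2
                  == (a1 ^+ 2 - 3 * a2) ^+ 2 %[mod p%:Z])%Z then 0%N
         else 1%N).
Proof.
set f := cubic a1 a2 a3; set D := disc f.
(* G = 27 f(-a1 / 3) *)
pose G := 2 * a1 ^+ 3 - 9 * a1 * a2 + 27 * a3.
pose E := a1 ^+ 2 - 3 * a2.
(* Outside these primes, each listed integer vanishes in K only if it is 0. A zero entry adds no
   exception, as [primes 0] is empty. *)
exists (flatten [seq primes `|m| | m <- [:: 2; 3; D; E; G]]) => p p_pr p_exc.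
have [K [iota _]] := countable_algebraic_closure 'F_p.
have pK : p \in [pchar K] by rewrite (fmorph_pchar iota) pchar_Fp.
have neq0K (m : int) : m \in [:: 2; 3; D; E; G] -> m != 0 -> m%:~R != 0 :> K.
  move=> ms m0; rewrite -(dvdz_pcharf pK); apply: contra p_exc => p_m.
  apply/flatten_mapP; exists m => //.
  by rewrite mem_primes p_pr absz_gt0 m0.
have modK (m n : int) : (m == n %[mod p%:Z])%Z = (m%:~R == n%:~R :> K).
  by rewrite eqz_mod_dvd (dvdz_pcharf pK) rmorphB subr_eq0.
have [[[x y] z] fK] := cubic_splits (K := K) a1 a2 a3.
have [a1K a2K a3K] := cubic_Vieta fK.
have DK : D%:~R = vandermonde3 x y z ^+ 2.
  have -> : D%:~R = discriminant3 a1%:~R a2%:~R a3%:~R :> K.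
    by rewrite /D disc_cubic /discriminant3; ring.
  by rewrite a1K a2K a3K /discriminant3 /vandermonde3; ring.
have V0 : vandermonde3 x y z != 0.
  by rewrite -sqrf_eq0 -DK neq0K ?inE ?eqxx ?orbT //; apply/eqP.
have EK : E%:~R = (x + y + z) ^+ 2 - 3 * (x * y + x * z + y * z).
  have -> : E%:~R = a1%:~R ^+ 2 - 3 * a2%:~R :> K by rewrite /E; ring.
  by rewrite a1K a2K sqrrN.
have UK : (U p.-1)%:~R * vandermonde3 x y z = alternating (pFrobenius_aut pK) x y z.
  rewrite (@alternating_recurrence _ x y z (fun n => (U n)%:~R)).
  - by rewrite (prednK (prime_gt0 p_pr)) /alternating !pFrobenius_autE.
  - by rewrite U0.
  - by rewrite U1.
  - by rewrite U2 rmorphN /= a1K opprK.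
  move=> n; have /(congr1 (intr : int -> K)) := Urec n.
  rewrite !(rmorphD, rmorphM) /= a1K a2K a3K rmorph0 => <-; ring.
have DUK : (D * U p.-1 ^+ 2)%:~R = alternating (pFrobenius_aut pK) x y z ^+ 2.
  by rewrite -UK rmorphM rmorphXn /= DK; ring.
rewrite (Np_count_fixed pK _ fK); last first.
  move: V0; rewrite /vandermonde3 !mulf_eq0 !subr_eq0 /= !inE andbT.
  by rewrite !negb_or.
rewrite !modK DUK rmorphXn /= EK rmorph0.
have rootsE t : root (map_poly intr f) t = (t \in [:: x; y; z]).
  by rewrite fK root_prod_XsubC.
transitivity (count (fun t => pFrobenius_aut pK t == t) [:: x; y; z]).
  by [].
apply: count_fixed_roots => //.
- by apply: (neq0K 2).
- by apply: (neq0K 3).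
- by move=> t; rewrite -!rootsE; apply: root_Frobenius.
- move=> t ts tmean.
  have G0 : G = 0.
    apply/eqP; apply: contraT => /neq0K; rewrite !inE eqxx !orbT => /(_ isT).
    have -> : G%:~R = 2 * a1%:~R ^+ 3 - 9 * a1%:~R * a2%:~R + 27 * a3%:~R :> K.
      by rewrite /G; ring.
    rewrite a1K a2K a3K.
    (* This factors 27 f(-a1/3) over the roots, with -a1 = x + y + z; the factor of t vanishes. *)
    rewrite (_ : _ + _ = - ((3 * x - (x + y + z)) * (3 * y - (x + y + z))
      * (3 * z - (x + y + z)))); last by ring.
    move: ts; rewrite -tmean !inE => /or3P[] /eqP ->;
      by rewrite subrr ?mulr0 ?mul0r ?oppr0 eqxx.
  have [r fr rmean] := integer_mean_root _ _ _ G0.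
  have [s Ds] := hmean r fr rmean.
  (* V is thus plus or minus the image of an integer, which Frobenius fixes. *)
  have /eqP : vandermonde3 x y z ^+ 2 = s%:~R ^+ 2 by rewrite -DK /D Ds rmorphXn.
  by rewrite eqf_sqr => /orP[] /eqP ->; rewrite ?rmorphN rmorph_int.
- rewrite -EK => E0K.
  (* Since p is not exceptional, E = 0 already over the integers; the integer root from [hpure] then
     maps to a fixed root. *)
  have /hpure[r fr] : a1 ^+ 2 = 3 * a2.
    apply/eqP; rewrite -subr_eq0; apply: contraT => /neq0K; rewrite E0K eqxx.
    by rewrite !inE eqxx !orbT => /(_ isT).
  exists r%:~R; last by rewrite rmorph_int.
  by rewrite -rootsE; apply: rmorph_root.
Qed.
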